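(* For integers $m\ge1$ and positive integers $s$, let $P_{2m}(s)=\mathbb E(X_1+\cdots+X_s)^{2m}$, where $X_1,\dots,X_s$ are i.i.d. Rademacher random variables, and write $P_{2m}(s)=\sum_{k=0}^m a^{2m}_k s^{m-k}$ as a polynomial in $s$. Then for every $s\in\mathbb N$ and every integer $l\ge0$, $$\sum_{k=0}^{2l+1}a^{2m}_ks^{m-k}\le P_{2m}(s)\le\sum_{k=0}^{2l}a^{2m}_ks^{m-k},$$ where the left inequality is asserted whenever $2l+1\le m$ and the right inequality whenever $2l\le m$.
   Context: A Rademacher random variable takes the values $\pm1$ with probability $1/2$ each. For each $m$, $P_{2m}(s)$ is a polynomial in $s$ of degree $m$ with integer coefficients; $a^{2m}_k$ denotes its coefficient of $s^{m-k}$. *)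

(* Defs.v *)
From HB Require Import structures.
From mathcomp Require Import all_boot all_order all_algebra.
From mathcomp Require Import all_classical all_reals all_analysis.

Set Implicit Arguments.
Unset Strict Implicit.
Unset Printing Implicit Defensive.

Import Order.TTheory GRing.Theory Num.Theory.

Local Open Scope classical_set_scope.
Local Open Scope ring_scope.

Definition rademacher (R : realType) (d : measure_display)
    (T : measurableType d) (Pr : probability T R) (X : {RV Pr >-> R}) : Prop :=
  Pr (X @^-1` [set 1]) = (2^-1)%:E /\ Pr (X @^-1` [set -1]) = (2^-1)%:E.

(* Mutual independence: the product rule holds on every subfamily [J]. *)
Definition independent_RVs (R : realType) (d : measure_display)
    (T : measurableType d) (Pr : probability T R) (I : finType)
    (X : I -> {RV Pr >-> R}) : Prop :=
  forall (J : {set I}) (B : I -> set R),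
    (forall i, measurable (B i)) ->
    Pr (\bigcap_(i in [set` J]) (X i @^-1` B i)) =
    (\prod_(i in J) Pr (X i @^-1` B i))%E.

Definition iid_rademacher (R : realType) (d : measure_display)
    (T : measurableType d) (Pr : probability T R) (s : nat)
    (X : 'I_s -> {RV Pr >-> R}) : Prop :=
  independent_RVs X /\ forall i, rademacher (X i).

(* The coefficient of s^(m-k), i.e. a_k^{2m} when [P] is the polynomial P_{2m}. *)
Definition acoef (m : nat) (P : {poly int}) (k : nat) : int := P`_(m - k).

(* Main.v *)
(* The moments satisfy E S_s^(2n) / (2n)! = [t^(2n)] cosh(t)^s, and
   (cosh^s)' = s tanh cosh^s expresses the n-th moment as s times a combination
   of the lower ones, whose coefficients are the alternating Taylor coefficients
   of tanh.  Truncating this recursion in the degree of s, the truncated lower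
   moments have the right sign by induction; the moments which the truncation
   leaves intact contribute a coefficient of (tanh - tanh_n) cosh^s, where tanh_n
   is a Taylor polynomial of tanh.  As s >= 1, the sign of that coefficient
   follows from the case s = 1, i.e. from sinh - tanh_n cosh, which is an
   alternating sum with increasing terms. *)

Require Import Defs.
From HB Require Import structures.
From mathcomp Require Import all_boot all_order all_algebra.
From mathcomp Require Import all_classical all_reals all_analysis.
From mathcomp Require Import measurable_realfun.
From mathcomp Require Import ring lra zify.

Set Implicit Arguments.
Unset Strict Implicit.
Unset Printing Implicit Defensive.

Import Order.TTheory GRing.Theory Num.Theory.

Local Open Scope classical_set_scope.
Local Open Scope ring_scope.

(** * Taylor coefficients of the tangent *)

(* Course-of-values recursion: [g n] may use the values at [0, ..., n]. *)
Fixpoint cvals (T : Type) (x0 : T) (g : nat -> (nat -> T) -> T) (n : nat) :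
    nat -> T :=
  if n is n'.+1 then
    fun k => if (k <= n')%N then cvals x0 g n' k else g n' (cvals x0 g n')
  else fun=> x0.

Definition cvrec (T : Type) (x0 : T) (g : nat -> (nat -> T) -> T) (n : nat) :=
  cvals x0 g n n.

Lemma cvals_le (T : Type) (x0 : T) g n k : (k <= n)%N ->
  cvals x0 g n k = cvrec x0 g k.
Proof.
elim: n k => [|n IH] k; first by rewrite leqn0 => /eqP ->.
rewrite leq_eqVlt => /predU1P[-> //|kn] /=.
by rewrite -ltnS kn IH.
Qed.

(** The table [cvals x0 g n] agrees with [cvrec] only up to n; the hypothesis says that [g n] reads
    no further. *)
Lemma cvrecS (T : Type) (x0 : T) g n :
  (forall f h, (forall k, (k <= n)%N -> f k = h k) -> g n f = g n h) ->
  cvrec x0 g n.+1 = g n (cvrec x0 g).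
Proof.
by move=> gE; rewrite /cvrec /= ltnn; apply: gE => k kn; apply: cvals_le.
Qed.

(* tan t = \sum_n tanc n * t^(2n+1); the recursion is tan' = 1 + tan^2. *)
Definition tanc (F : realFieldType) : nat -> F :=
  cvrec 1 (fun n t => (\sum_(i < n.+1) t i * t (n - i)%N) / (2 * n + 3)%:R).

Lemma tancS (F : realFieldType) n :
  (2 * n + 3)%:R * tanc F n.+1 = \sum_(i < n.+1) tanc F i * tanc F (n - i).
Proof.
rewrite /tanc cvrecS => [|f h fh].
  by rewrite mulrC mulfVK // pnatr_eq0 addn3.
congr (_ / _); apply: eq_bigr => i _.
by rewrite !fh ?leq_subr // -ltnS.
Qed.

Lemma tanc_ge0 (F : realFieldType) n : 0 <= tanc F n.
Proof.
elim/ltn_ind: n => -[|n] IH; first exact: ler01.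
rewrite -(pmulr_rge0 _ (x := (2 * n + 3)%:R)) ?ltr0n ?addn3 // -addn3 tancS.
by apply: sumr_ge0 => i _; rewrite mulr_ge0 // IH // ltnS ?leq_subr // -ltnS.
Qed.

(** Comparing the convolutions of [tancS] at n and n+1 term by term yields (2n+6) t_(n+1) <= 3
    (2n+5) t_(n+2). Equality at the start, t_0 = 1 and t_1 = 1/3, dictates the constant 3. *)
Lemma tanc_leS (F : realFieldType) n : tanc F n <= 3 * tanc F n.+1.
Proof.
elim/ltn_ind: n => -[|n] IH.
  have := tancS F 0; rewrite muln0 add0n big_ord1 subnn => ->.
  by rewrite -[leLHS]mulr1.
have e2 := tancS F n.+1; have e1 := tancS F n.
rewrite big_ord_recr /= subnn [tanc F 0]/(1 : F) mulr1 in e2.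
have : \sum_(i < n.+1) tanc F i * tanc F (n - i) <=
       3 * \sum_(i < n.+1) tanc F i * tanc F (n.+1 - i).
  rewrite mulr_sumr; apply: ler_sum => i _; rewrite mulrCA.
  have ile : (i <= n)%N by rewrite -ltnS.
  rewrite (subSn ile); apply: ler_wpM2l; first exact: tanc_ge0.
  by apply: IH; rewrite ltnS leq_subr.
rewrite -e1; have := tanc_ge0 F n.+1.
move: e2; rewrite !natrD !natrM -[n.+1%:R]natr1.
set S := \sum_(i < _) _; move=> e2 t0 le.
have n0 : 0 <= n%:R :> F by [].
rewrite -(ler_pM2l (_ : 0 < 2 * n%:R + 5)); last by lra.
nra.
Qed.

(** * Truncated series of cosh, sinh, tanh and their differential equations *)

Lemma coefM_eq0 (A : comNzRingType) N (e p : {poly A}) :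
  (forall i, (i < N)%N -> e`_i = 0) -> forall i, (i < N)%N -> (e * p)`_i = 0.
Proof.
move=> e0 i iN; rewrite coefM big1 // => j _.
by rewrite e0 ?mul0r // (leq_ltn_trans _ iN) // -ltnS.
Qed.

Lemma natr_mulS (A : pzRingType) n (x : A) : n%:R * x + x = n.+1%:R * x.
Proof. by rewrite !mulr_natl mulrSr. Qed.

(* Truncated series in x = t^2: [coshp], [sinhp] and [tanhp] stand for cosh t,
   (sinh t) / t and (tanh t) / t. *)
Definition coshp (F : realFieldType) (N : nat) : {poly F} :=
  \poly_(i < N) ((2 * i)`!%:R)^-1.
Definition sinhp (F : realFieldType) (N : nat) : {poly F} :=
  \poly_(i < N) ((2 * i + 1)`!%:R)^-1.
Definition tanhc (F : realFieldType) (i : nat) : F := (-1) ^+ i * tanc F i.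
Definition tanhp (F : realFieldType) (N : nat) : {poly F} :=
  \poly_(i < N) tanhc F i.

(* t d/dt in the variable x = t^2. *)
Definition euler (F : realFieldType) (p : {poly F}) : {poly F} :=
  2%:R *: ('X * p^`()).

Lemma coef_euler (F : realFieldType) (p : {poly F}) i :
  (euler p)`_i = (2 * i)%:R * p`_i.
Proof.
rewrite coefZ coefXM coef_deriv; case: i => [|i] /=; first by rewrite mulr0 mul0r.
by rewrite natrM -mulrA [_%:R * p`__]mulr_natl.
Qed.

Lemma eulerM (F : realFieldType) (p q : {poly F}) :
  euler (p * q) = euler p * q + p * euler q.
Proof. by rewrite /euler derivM -!mul_polyC; ring. Qed.

Lemma eulerB (F : realFieldType) (p q : {poly F}) :
  euler (p - q) = euler p - euler q.
Proof. by rewrite /euler derivB -!mul_polyC; ring. Qed.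

Lemma fact_inv (F : realFieldType) n : n.+1%:R * (n.+1`!%:R)^-1 = (n`!%:R)^-1 :> F.
Proof.
by rewrite factS natrM invfM mulrA mulfV ?mul1r // pnatr_eq0.
Qed.

Lemma euler_coshp (F : realFieldType) N i : (i < N)%N ->
  (euler (coshp F N) - 'X * sinhp F N)`_i = 0.
Proof.
move=> iN; rewrite coefB coef_euler coefXM !coef_poly iN.
case: i iN => [|i] iN /=; first by rewrite mul0r subr0.
by rewrite ltnW // mulnS fact_inv addn1 subrr.
Qed.

Lemma euler_sinhp (F : realFieldType) N :
  euler (sinhp F N) + sinhp F N = coshp F N.
Proof.
apply/polyP => i; rewrite coefD coef_euler !coef_poly.
case: ltnP => _; last by rewrite mulr0 addr0.
by rewrite natr_mulS addn1 fact_inv.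
Qed.

(** This is tanh' = 1 - tanh^2 rewritten for u = (tanh t) / t, that is t u' + u = 1 - x u^2. *)
Lemma euler_tanhp (F : realFieldType) N i : (i < N)%N ->
  (euler (tanhp F N) + tanhp F N - 1 + 'X * tanhp F N ^+ 2)`_i = 0.
Proof.
move=> iN; rewrite !coefD coefN coef1 coef_euler coefXM coef_poly iN.
case: i iN => [|i] iN.
  by rewrite eqxx mul0r add0r addr0 /tanhc expr0 mul1r subrr.
rewrite subr0 natr_mulS expr2 coefM /= /tanhc mulrCA.
rewrite (_ : (2 * i.+1).+1 = 2 * i + 3)%N; last by lia.
rewrite tancS mulr_sumr -big_split /= big1 // => j _.
have ji : (j <= i)%N by rewrite -ltnS.
rewrite !coef_poly ifT; last by lia.
rewrite ifT; last by lia.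
rewrite /tanhc mulrACA -exprD subnKC // exprS; ring.
Qed.

(* V = sinh - tanh cosh solves V' = - tanh V with V(0) = 0. *)
Lemma tanhp_coshp (F : realFieldType) N i : (i < N)%N ->
  (sinhp F N - tanhp F N * coshp F N)`_i = 0.
Proof.
set V := _ - _.
pose e1 := euler (coshp F N) - 'X * sinhp F N.
pose e2 := euler (tanhp F N) + tanhp F N - 1 + 'X * tanhp F N ^+ 2.
have VE : euler V + V = - ('X * (tanhp F N * V)) - (e2 * coshp F N + e1 * tanhp F N).
  rewrite /V /e1 /e2 eulerB eulerM.
  have -> : euler (sinhp F N) = coshp F N - sinhp F N.
    by rewrite -(euler_sinhp F N) addrK.
  ring.
move: V VE => V VE.
(* At degree i the equation expresses (2i+1) V_i through V_j with j < i. *)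
elim/ltn_ind: i => i IH iN.
have := congr1 (fun p : {poly F} => p`_i) VE.
rewrite !(coefB, coefD, coefN) coef_euler.
rewrite (coefM_eq0 _ (@euler_tanhp F N)) // (coefM_eq0 _ (@euler_coshp F N)) //.
rewrite addr0 subr0 coefXM natr_mulS.
case: i IH iN => [|i] IH iN /=.
  by rewrite oppr0 mul1r.
rewrite coefM big1 ?oppr0 => [|j _].
  by move/eqP; rewrite mulf_eq0 pnatr_eq0 /= => /eqP.
by rewrite IH ?mulr0 // ?ltnS ?leq_subr //; lia.
Qed.

(** Read off degree n+1 in t (cosh^s)' = s t tanh cosh^s; the truncation defects [e1] and [e2]
    vanish below degree N. *)
Lemma coef_coshpX_rec (F : realFieldType) N s n : (n.+1 < N)%N ->
  (2 * n.+1)%:R * (coshp F N ^+ s)`_n.+1 =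
  s%:R * \sum_(i < n.+1) tanhc F i * (coshp F N ^+ s)`_(n - i).
Proof.
move=> nN; set C := coshp F N.
pose e1 := euler C - 'X * sinhp F N.
pose e2 := sinhp F N - tanhp F N * C.
have CE : euler (C ^+ s) - s%:R%:P * ('X * (tanhp F N * C ^+ s)) =
    (e1 + e2 * 'X) * (s%:R%:P * C ^+ s.-1).
  have -> : euler (C ^+ s) = s%:R%:P * C ^+ s.-1 * euler C.
    by rewrite /euler deriv_exp -!mul_polyC polyC_natr -mulr_natl; ring.
  rewrite /e1 /e2; case: s => [|s] /=; first by rewrite polyC0; ring.
  by rewrite exprS; ring.
have := congr1 (fun p : {poly F} => p`_n.+1) CE.
rewrite [RHS](@coefM_eq0 _ N) // => [|i iN]; last first.
  rewrite coefD (@euler_coshp F N i iN) add0r.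
  by rewrite (coefM_eq0 _ (@tanhp_coshp F N)).
rewrite coefB coef_euler coefCM coefXM /= => /subr0_eq ->.
rewrite coefM; congr (_ * _); apply: eq_bigr => i _.
by rewrite coef_poly ifT //; have := ltn_ord i; lia.
Qed.

(** * Signs of the tails of the tanh series *)

Lemma sinhp_tail_ge0 (F : realFieldType) N n M : (n <= M)%N -> (M < N)%N ->
  0 <= (-1) ^+ n *
    (sinhp F N - (\poly_(i < n) tanhc F i) * coshp F N)`_M.
Proof.
move=> nM MN.
(* [c n] is the alternating sum b n.-1 - b n.-2 + ..., started at 1/(2M+1)!. *)
pose b i : F := tanc F i / ((2 * (M - i))`!)%:R.
pose c n : F := (-1) ^+ n * (((2 * M + 1)`!%:R)^-1 - \sum_(i < n) (-1) ^+ i * b i).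
have cS k : c k.+1 = b k - c k.
  rewrite /c big_ord_recr /= exprS.
  have := sqrr_sign F k; rewrite expr2 => e.
  by rewrite -[X in _ = X - _]mul1r -[X in _ = X * _ - _]e; ring.
(* By [tanc_leS] the terms grow at least by the factor (q+1)(q+2)/3, with q as below; for q = 0 this
   is only 2/3, whence the bound k+1 < M. *)
have bS k : (k.+1 < M)%N -> b k <= b k.+1.
  move=> kM; rewrite /b.
  have -> : (2 * (M - k) = (2 * (M - k.+1)).+2)%N by lia.
  set q := (2 * (M - k.+1))%N; have q2 : (2 <= q)%N by rewrite /q; lia.
  rewrite !factS !natrM !invfM mulrA mulrA.
  rewrite ler_wpM2r ?invr_ge0 //.
  rewrite -invfM ler_pdivrMr ?mulr_gt0 ?ltr0n //.
  apply: le_trans (tanc_leS F k) _; rewrite mulrC ler_wpM2l ?tanc_ge0 //.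
  by rewrite -natrM ler_nat; nia.
(* By [cS] and the bounds at k, c (k+1) lies between 0 and b k, and b k <= b (k+1). *)
have cb k : (k < M)%N -> 0 <= c k <= b k.
  elim: k => [|k IH] kM.
    rewrite /c big_ord0 expr0 mul1r subr0 invr_ge0 ler0n /=.
    rewrite /b subn0 mul1r lef_pV2 ?posrE ?ltr0n ?fact_gt0 //.
    by rewrite ler_nat addn1 factS leq_pmull.
  have /andP[c0 cle] := IH (ltnW kM).
  by rewrite cS subr_ge0 cle /= (le_trans _ (bS _ kM)) // gerBl.
suff -> : (sinhp F N - (\poly_(i < n) tanhc F i) * coshp F N)`_M =
    ((2 * M + 1)`!%:R)^-1 - \sum_(i < n) (-1) ^+ i * b i.
  (* The case n = M lies outside [cb], but c M = b (M-1) - c (M-1) uses only the bound at M-1. *)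
  rewrite -/(c n); move: nM; rewrite leq_eqVlt => /predU1P[->|/cb/andP[]//].
  case: M @b @c cS bS cb {MN} => [|M] b c cS _ cb.
    by rewrite /c big_ord0 expr0 mul1r subr0 invr_ge0 ler0n.
  by rewrite cS subr_ge0; case/andP: (cb M (ltnSn M)).
rewrite coefB coef_poly MN coefM; congr (_ - _).
rewrite (big_ord_widen M.+1 (fun i => (-1) ^+ i * b i)) ?leqW //.
rewrite [RHS]big_mkcond; apply: eq_bigr => i _.
rewrite coef_poly; case: ltnP => _; last by rewrite mul0r.
rewrite coef_poly ifT; last by rewrite (leq_ltn_trans _ MN) ?leq_subr.
by rewrite /tanhc /b mulrA.
Qed.

Lemma coef_coshpX_ge0 (F : realFieldType) N s i : 0 <= (coshp F N ^+ s)`_i.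
Proof.
elim: s i => [|s IH] i; first by rewrite expr0 coef1 ler0n.
rewrite exprS coefM sumr_ge0 // => j _; rewrite mulr_ge0 // coef_poly.
by case: ifP => // _; rewrite invr_ge0.
Qed.

(** Since (tanh - tanh_n) cosh^s = (sinh - tanh_n cosh) cosh^(s-1) and cosh^(s-1) has nonnegative
    coefficients, the sign is inherited from s = 1. *)
Lemma tanh_tail_ge0 (F : realFieldType) N s n M : (0 < s)%N -> (M < N)%N ->
  0 <= (-1) ^+ n * \sum_(n <= i < M.+1) tanhc F i * (coshp F N ^+ s)`_(M - i).
Proof.
case: s => // s _ MN.
have [nM|Mn] := leqP n M; last by rewrite big_geq ?mulr0.
set C := coshp F N; pose Tn := \poly_(i < n) tanhc F i.
have e i : (i < N)%N -> (sinhp F N - tanhp F N * C)`_i = 0 by apply: tanhp_coshp.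
suff -> : \sum_(n <= i < M.+1) tanhc F i * (C ^+ s.+1)`_(M - i) =
    ((sinhp F N - Tn * C) * C ^+ s)`_M.
  rewrite coefM mulr_sumr sumr_ge0 // => i _; rewrite mulrA.
  have iM : (i <= M)%N by rewrite -ltnS.
  have [ni|ilt] := leqP n i.
    rewrite mulr_ge0 ?coef_coshpX_ge0 // sinhp_tail_ge0 //; lia.
  (* Below degree n, [Tn] and [tanhp] have the same coefficients. *)
  suff -> : (sinhp F N - Tn * C)`_i = 0 by rewrite mulr0 mul0r.
  have iN : (i < N)%N by lia.
  rewrite -[RHS](e _ iN) !coefB; congr (_ - _); rewrite !coefM.
  apply: eq_bigr => j _; rewrite !coef_poly !ifT //; have := ltn_ord j; lia.
have -> : (sinhp F N - Tn * C) * C ^+ s =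
    (sinhp F N - tanhp F N * C) * C ^+ s + (tanhp F N - Tn) * C ^+ s.+1.
  by rewrite exprS; ring.
rewrite coefD (coefM_eq0 _ e) // add0r coefM.
rewrite (big_nat_widenl _ 0) // big_mkord [LHS]big_mkcond /=; apply: eq_bigr => i _.
have iN : (i < N)%N by have := ltn_ord i; lia.
rewrite coefB !coef_poly iN.
by rewrite ltnNge; case: leqP => _ /=; rewrite ?subr0 ?subrr ?mul0r.
Qed.

(** * The moment polynomials and their truncations *)

(* The polynomial in s whose values are the coefficients [t^(2n)] cosh(t)^s. *)
Definition momp (F : realFieldType) : nat -> {poly F} :=
  cvrec 1 (fun n q =>
    (2 * n.+1)%:R^-1 *: ('X * \sum_(i < n.+1) tanhc F i *: q (n - i)%N)).

Lemma mompS (F : realFieldType) n :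
  (2 * n.+1)%:R *: momp F n.+1 =
  'X * \sum_(i < n.+1) tanhc F i *: momp F (n - i).
Proof.
rewrite /momp cvrecS => [|f h fh].
  by rewrite scalerA mulfV ?scale1r // pnatr_eq0.
congr (_ *: (_ * _)); apply: eq_bigr => i _.
by rewrite fh // leq_subr.
Qed.

Lemma size_momp (F : realFieldType) n : (size (momp F n) <= n.+1)%N.
Proof.
elim/ltn_ind: n => -[|n] IH; first by rewrite size_poly1.
rewrite -(size_scale _ (_ : (2 * n.+1)%:R != 0 :> F)) ?pnatr_eq0 // mompS.
rewrite mulrC; apply: leq_trans (size_polyMleq _ _) _; rewrite size_polyX addn2 /=.
rewrite ltnS; apply: leq_trans (size_sum _ _ _) _; apply/bigmax_leqP => i _.
apply: leq_trans (size_scale_leq _ _) _.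
by apply: leq_trans (IH _ _) _; rewrite ltnS leq_subr.
Qed.

Lemma horner_momp (F : realFieldType) N n s : (n < N)%N ->
  (momp F n).[s%:R] = (coshp F N ^+ s)`_n.
Proof.
elim/ltn_ind: n => -[|n] IH nN.
  rewrite hornerC; elim: s {IH} => [|s IHs]; first by rewrite expr0 coef1.
  by rewrite exprS coefM big_ord1 -IHs coef_poly nN fact0 invr1 mulr1.
have n0 : (2 * n.+1)%:R != 0 :> F by rewrite pnatr_eq0.
apply: (mulfI n0); rewrite -hornerZ mompS coef_coshpX_rec //.
rewrite hornerM hornerX horner_sum; congr (_ * _); apply: eq_bigr => i _.
by rewrite hornerZ IH // ?ltnS ?leq_subr //; lia.
Qed.

(** The exponent m+1-d counts the leading powers removed by [take_poly d]. The induction runs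
    through [mompS], whose factor ['X] lowers d by one. *)
Lemma take_poly_momp_ge0 (F : realFieldType) s m d : (0 < s)%N -> (d <= m.+1)%N ->
  0 <= (-1) ^+ (m.+1 - d) * (take_poly d (momp F m)).[s%:R].
Proof.
move=> s0; elim/ltn_ind: m d => -[|m] IH [|d] dm.
- by rewrite take_poly0l horner0 mulr0.
- have -> : d = 0%N by lia.
  by rewrite subnn mul1r take_poly_id ?size_poly1 // hornerC.
- by rewrite take_poly0l horner0 mulr0.
rewrite subSS.
have n0 : 0 < (2 * m.+1)%:R :> F by rewrite ltr0n.
rewrite -(pmulr_rge0 _ n0) mulrCA -hornerZ -take_polyZ mompS.
have -> (p : {poly F}) : take_poly d.+1 ('X * p) = 'X * take_poly d p.
  apply/polyP => i; rewrite coef_take_poly !coefXM coef_take_poly.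
  by case: i => [|i] //=.
rewrite hornerM hornerX mulrCA mulr_ge0 //.
rewrite take_poly_sum horner_sum.
(* For i >= n the truncation leaves [momp F (m - i)] intact, so the sum is split at n. *)
set n := (m.+1 - d)%N; have nm : (n <= m.+1)%N by rewrite leq_subr.
rewrite -(big_mkord xpredT
  (fun i => (take_poly d (tanhc F i *: momp F (m - i))).[s%:R])).
rewrite (big_cat_nat (n := n)) //= mulrDr addr_ge0 //.
  rewrite mulr_sumr big_nat sumr_ge0 // => i /andP[_ ilt].
  have idm : (d <= (m - i).+1)%N by rewrite /n in ilt; lia.
  have := IH (m - i)%N (leq_subr _ _) d idm.
  (* The sign (-1)^n factors into that of the induction hypothesis and (-1)^i, which cancels the
     sign of [tanhc F i]. *)
  have -> : n = ((m - i).+1 - d + i)%N by rewrite /n in ilt *; lia.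
  rewrite take_polyZ hornerZ /tanhc exprD; set v := (_).[_] => v0.
  set a := (-1) ^+ (_ - d) in v0 *.
  have -> : a * (-1) ^+ i * ((-1) ^+ i * tanc F i * v) =
    (-1) ^+ i ^+ 2 * (tanc F i * (a * v)) by ring.
  by rewrite sqrr_sign mul1r mulr_ge0 ?tanc_ge0.
have := @tanh_tail_ge0 F m.+1 s n m s0 (ltnSn m).
congr (_ <= _ * _); apply: eq_big_nat => i /andP[ni im].
rewrite take_polyZ hornerZ take_poly_id.
  by rewrite (@horner_momp F m.+1) // ltnS leq_subr.
by apply: leq_trans (size_momp _ _) _; rewrite /n in ni; lia.
Qed.

(** * Even moments of Rademacher sums *)

(** By independence each sign pattern has probability 2^-s; these 2^s disjoint events fill the space
    up to a null set, so the integral is a finite sum over them. *)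
Lemma expectation_even_rademacher (R : realType) (d : measure_display)
    (T : measurableType d) (Pr : probability T R) (s m : nat)
    (X : 'I_s -> {RV Pr >-> R}) : iid_rademacher X ->
  ('E_Pr[fun w => ((\sum_(i < s) X i w) ^+ (2 * m))%R])%E =
  (2^-1 ^+ s * \sum_(e : {ffun 'I_s -> bool})
    (\sum_(i < s) (-1) ^+ e i) ^+ (2 * m))%:E.
Proof.
move=> [indX radX].
pose A (e : {ffun 'I_s -> bool}) : set T :=
  \bigcap_(i in [set` [set: 'I_s]%SET]) (X i @^-1` [set (-1) ^+ e i]).
have AE e w : A e w -> forall i, X i w = (-1) ^+ e i.
  by move=> Aw i; apply: (Aw i); rewrite /= inE.
have mA e : measurable (A e).
  apply: fin_bigcap_measurable => [|i _]; first exact: finite_finset.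
  by rewrite -[X in measurable X]setTI; exact: measurable_funP.
have PA e : Pr (A e) = (2^-1 ^+ s)%:E.
  rewrite (indX _ (fun i => [set (-1) ^+ e i])) //.
  rewrite (eq_bigr (fun=> (2^-1)%:E)) => [|i _].
    by rewrite prodEFin prodr_const cardsT card_ord.
  by case: (radX i) => X1 XN1; case: (e i); rewrite ?expr1 ?expr0.
have tA : trivIset [set` index_enum {ffun 'I_s -> bool}] A.
  apply/trivIsetP => e1 e2 _ _ /eqP ne; rewrite -subset0 => w [/AE h1 /AE h2].
  by apply: ne; apply/ffunP => i; apply: (@signr_inj R); rewrite -h1 h2.
set D := \big[setU/set0]_(e <- index_enum {ffun 'I_s -> bool}) A e.
have mD : measurable D by apply: bigsetU_measurable.
have PD : Pr D = 1%E.
  rewrite -[LHS]mul1e -(integral_cst Pr mD 1%E) ge0_integral_bigsetU //=.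
  - rewrite (eq_bigr (fun=> (2^-1 ^+ s)%:E)) => [|e _]; last first.
      by rewrite (integral_cst Pr (mA e) 1%E) mul1e; exact: PA.
    rewrite sumEFin sumr_const card_ffun card_bool card_ord -[_ *+ (2 ^ s)]mulr_natl.
    by rewrite natrX -exprMn mulfV ?expr1n // pnatr_eq0.
  - exact: index_enum_uniq.
rewrite unlock.
pose f (w : T) : \bar R := ((\sum_(i < s) X i w) ^+ (2 * m))%:E.
have mf B : measurable_fun B f.
  apply: measurable_funTS; apply/measurable_EFinP; apply: measurable_funX.
  by apply: measurable_sum.
have f0 w : (0 <= f w)%E by rewrite lee_fin mulnC exprM sqr_ge0.
rewrite (@ge0_negligible_integral _ _ _ _ setT (~` D) f) //; first last.
- by have := probability_setC Pr mD; rewrite PD subee.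
- exact: measurableC.
rewrite setTD setCK ge0_integral_bigsetU //; last exact: index_enum_uniq.
rewrite mulr_sumr -sumEFin; apply: eq_bigr => e _.
rewrite (eq_integral (cst ((\sum_(i < s) (-1) ^+ e i) ^+ (2 * m))%:E)); last first.
  move=> w /set_mem /AE Aw; rewrite /=; congr (_ ^+ _)%:E.
  by apply: eq_bigr => i _; rewrite Aw.
rewrite (integral_cst Pr (mA e)) EFinM muleC; congr (_ * _)%E; exact: PA.
Qed.

(* Truncated series of exp(a t), in the variable t. *)
Definition expp (F : realFieldType) (K : nat) (a : F) : {poly F} :=
  \poly_(k < K) (a ^+ k / k`!%:R).

Lemma coef_exppM (F : realFieldType) K (a b : F) n : (n < K)%N ->
  (expp K a * expp K b)`_n = (expp K (a + b))`_n.
Proof.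
move=> nK; rewrite coefM coef_poly nK addrC exprDn mulr_suml; apply: eq_bigr => i _.
have iN : (i <= n)%N by rewrite -ltnS.
rewrite !coef_poly !ifT; try lia.
have f0 k : k`!%:R != 0 :> F by rewrite pnatr_eq0 -lt0n fact_gt0.
rewrite -(bin_fact iN) natrM natrM -mulr_natl.
have b0 : 'C(n, i)%:R != 0 :> F by rewrite pnatr_eq0 -lt0n bin_gt0.
by field; rewrite !f0 b0.
Qed.

Lemma coef_expp_prod (F : realFieldType) K s (a : 'I_s -> F) n : (n < K)%N ->
  (\prod_(i < s) expp K (a i))`_n = (expp K (\sum_(i < s) a i))`_n.
Proof.
elim: s a n => [|s IH] a n nK.
  rewrite !big_ord0 coef1 coef_poly nK expr0n.
  by case: n {nK} => [|n]; rewrite ?divr1 ?mul0r.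
rewrite !big_ord_recl -coef_exppM // !coefM; apply: eq_bigr => i _.
by rewrite IH // (leq_ltn_trans _ nK) // leq_subr.
Qed.

(** Here exp t + exp (-t) = 2 cosh t; composition with ['X^2] returns from x to t, and cutting at 2N
    in t matches cutting at N in x. *)
Lemma expp_even (F : realFieldType) N :
  expp (2 * N) 1 + expp (2 * N) (-1) = 2%:P * (coshp F N \Po 'X^2).
Proof.
apply/polyP => i; rewrite coefD !coef_poly coefCM coef_comp_poly_Xn //.
rewrite expr1n -signr_odd dvdn2; case: (boolP (odd i)) => io /=.
  by case: ifP => _; rewrite ?addr0 ?mulr0 // mulNr mul1r subrr.
have e : (2 * (i %/ 2) = i)%N by rewrite mulnC divnK // dvdn2.
rewrite coef_poly e -[in RHS](ltn_pmul2l (m := 2)) // e.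
by case: ifP => _; rewrite ?addr0 ?mulr0 // mulr2n mulrDl !mul1r.
Qed.

(** Expand (exp t + exp (-t))^s = (2 cosh t)^s over sign patterns and compare coefficients of
    t^(2m). *)
Lemma even_moment_coshp (F : realFieldType) N s m : (m < N)%N ->
  2^-1 ^+ s * \sum_(e : {ffun 'I_s -> bool}) (\sum_(i < s) (-1) ^+ e i) ^+ (2 * m)
  = (2 * m)`!%:R * (coshp F N ^+ s)`_m.
Proof.
move=> mN.
have H : (\sum_(e : {ffun 'I_s -> bool})
      \prod_(i < s) expp (2 * N) ((-1) ^+ e i : F))`_(2 * m) =
    2 ^+ s * (coshp F N ^+ s)`_m.
  rewrite -(bigA_distr_bigA (fun (_ : 'I_s) (b : bool) => expp (2 * N) ((-1) ^+ b : F))).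
  rewrite prodr_const card_ord big_bool /= expr0 expr1 addrC expp_even.
  rewrite exprMn -polyC_exp -(rmorphXn (comp_poly 'X^2)) coefCM coef_comp_poly_Xn //.
  by rewrite dvdn_mulr // mulKn.
have f0 : (2 * m)`!%:R != 0 :> F by rewrite pnatr_eq0 -lt0n fact_gt0.
rewrite coef_sum (eq_bigr (fun e : {ffun 'I_s -> bool} =>
  ((2 * m)`!%:R)^-1 * (\sum_(i < s) (-1) ^+ e i) ^+ (2 * m))) in H; last first.
  by move=> e _; rewrite coef_expp_prod ?coef_poly ?ifT 1?mulrC // ltn_pmul2l.
rewrite -mulr_sumr in H; move: H; set S := \sum_e _; move=> H.
have -> : S = (2 * m)`!%:R * (2 ^+ s * (coshp F N ^+ s)`_m).
  by rewrite -H mulrA mulfV ?mul1r.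
by rewrite mulrCA exprVn mulKf // expf_neq0.
Qed.

(** * Transfer to the integer polynomial and conclusion *)

Lemma poly_eq_nat (F : numDomainType) (p q : {poly F}) :
  (forall s, (0 < s)%N -> p.[s%:R] = q.[s%:R]) -> p = q.
Proof.
move=> pq; apply/eqP; rewrite -subr_eq0; apply/negPn/negP => nz.
pose rs : seq F := [seq i.+1%:R | i <- iota 0 (size (p - q))].
suff : (size rs < size (p - q)%R)%N by rewrite size_map size_iota ltnn.
apply: max_poly_roots => //.
  by apply/allP => _ /mapP[i _ ->]; rewrite /root hornerD hornerN pq // subrr.
rewrite map_inj_uniq ?iota_uniq // => i j /eqP.
by rewrite eqr_nat eqSS => /eqP.
Qed.

(** The omitted terms form [take_poly (m - K) p], so each bound of the theorem becomes a sign
    condition on that truncation. *)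
Lemma sum_leading_coefs (A : comNzRingType) (p : {poly A}) m K x :
  size p = m.+1 -> (K <= m)%N ->
  \sum_(0 <= k < K.+1) p`_(m - k) * x ^+ (m - k) =
  p.[x] - (take_poly (m - K) p).[x].
Proof.
move=> sp Km; apply/eqP; rewrite eq_sym subr_eq addrC; apply/eqP.
rewrite horner_coef sp (horner_coef_wide _ (size_take_poly _ _)).
rewrite -(big_mkord xpredT (fun i => p`_i * x ^+ i)).
rewrite (big_cat_nat (n := (m - K)%N)) //=; last by lia.
congr (_ + _).
  by rewrite big_mkord; apply: eq_bigr => i _; rewrite coef_take_poly ltn_ord.
rewrite [RHS]big_nat_rev /= -{1}[(m - K)%N]add0n big_addn.
have -> : (m.+1 - (m - K) = K.+1)%N by lia.
apply: eq_big_nat => i /andP[_ iK].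
by have -> : (m - (0 + K.+1 - i.+1) = i + (m - K))%N by lia.
Qed.

Lemma take_poly_moment_ge0 (R : realFieldType) m (P : {poly int}) d s :
  (0 < m)%N -> map_poly intr P = (2 * m)`!%:R *: momp R m -> (d <= m.+1)%N ->
  0 <= (-1) ^+ (m.+1 - d) * (take_poly d P).[s%:Z].
Proof.
move=> m0 PE dm; rewrite -(ler_int R) rmorphM rmorphXn /= rmorphN rmorph1.
have -> : (take_poly d P).[s%:Z]%:~R = (take_poly d (map_poly intr P)).[s%:R] :> R.
  rewrite -[s%:R](rmorph_nat (intr : int -> R)) natz -horner_map; congr (_.[_]).
  by apply/polyP => i; rewrite coef_map !coef_take_poly coef_map; case: ifP.
rewrite PE take_polyZ hornerZ mulrCA mulr_ge0 //.
(* At s = 0 at most the constant term survives, and it is the coefficient of x^m in cosh^0 = 1, zero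
   since m > 0. *)
case: s => [|s]; last exact: take_poly_momp_ge0.
rewrite horner_coef0 coef_take_poly; case: ifP => _; last by rewrite mulr0.
rewrite -horner_coef0 (@horner_momp R m.+1 m 0) //.
by rewrite expr0 coef1 eqn0Ngt m0 mulr0.
Qed.

Theorem lemma7p2 (R : realType) (m : nat) (hm : (1 <= m)%N)
  (* for each s, i.i.d. Rademacher variables X_1, ..., X_s on some space *)
  (d : nat -> measure_display) (T : forall s : nat, measurableType (d s))
  (Pr : forall s : nat, probability (T s) R)
  (X : forall s : nat, 'I_s -> {RV (Pr s) >-> R})
  (iidX : forall s : nat, iid_rademacher (X s))
  (* P is the polynomial P_{2m} *)
  (P : {poly int}) (degP : size P = m.+1)
  (PE : forall s : nat, (0 < s)%N ->
     ('E_(Pr s)[fun w => ((\sum_(i < s) X s i w) ^+ (2 * m))%R])%E =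
     ((P.[s%:Z])%:~R)%:E) :
  forall s l : nat,
    ((2 * l + 1 <= m)%N ->
       \sum_(0 <= k < (2 * l + 1).+1) acoef m P k * s%:Z ^+ (m - k)
         <= P.[s%:Z]) /\
    ((2 * l <= m)%N ->
       P.[s%:Z]
         <= \sum_(0 <= k < (2 * l).+1) acoef m P k * s%:Z ^+ (m - k)).

Proof.
move=> s l.
have PQ : map_poly intr P = (2 * m)`!%:R *: momp R m.
  apply: poly_eq_nat => k k0; rewrite hornerZ (@horner_momp R m.+1) //.
  rewrite -even_moment_coshp //; apply: EFin_inj.
  rewrite -(expectation_even_rademacher m (iidX k)) PE //; congr _%:E.
  by rewrite -[k%:R](rmorph_nat (intr : int -> R)) natz horner_map.
have R_ge0 d0 := @take_poly_moment_ge0 R m P d0 s hm PQ.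
rewrite /acoef; split=> lm; rewrite sum_leading_coefs //.
(* Here 2l+2 leading terms are split off, an even number, so the remainder is nonnegative; for the
   upper bound it is 2l+1, and the remainder is nonpositive. *)
- have := R_ge0 (m - (2 * l + 1))%N _.
  have -> : (m.+1 - (m - (2 * l + 1)) = (l.+1).*2)%N by lia.
  rewrite -signr_odd odd_double mul1r gerBl; apply; lia.
- have := R_ge0 (m - 2 * l)%N _.
  have -> : (m.+1 - (m - 2 * l) = (l.*2).+1)%N by lia.
  rewrite -signr_odd /= odd_double mulN1r lerBrDr gerDl -oppr_ge0; apply; lia.
Qed.
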